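(* Let $\alpha\in(0,1]$ be fixed, let $a_\alpha^{\min}$ and $a_\alpha^{\max}$ be the smallest and largest eigenvalues of $\mathbf A_\alpha$ (which are real and positive), and let $\kappa = a_\alpha^{\max}/a_\alpha^{\min}$, assumed to satisfy $\kappa>1$. For real $c_1,c_{23}$ let $\rho(\boldsymbol\Upsilon(c_1,c_{23}))$ denote the spectral radius of $\boldsymbol\Upsilon(c_1,c_{23})$. (i) The minimum of $\rho(\boldsymbol\Upsilon(c_1,c_{23}))$ over all $(c_1,c_{23})\in\mathbb R^2$ is attained at $$c_1^*=\left(\frac{\sqrt\kappa-1}{\sqrt\kappa+1}\right)^2,\qquad c_{23}^*=\frac{4}{a_\alpha^{\min}(\sqrt\kappa+1)^2},$$ and the minimal value is $$\rho(\boldsymbol\Upsilon(c_1^*,c_{23}^* ))=\frac{\sqrt\kappa-1}{\sqrt\kappa+1}.$$ (ii) If $c_1=0$ is imposed, then the minimum of $\rho(\boldsymbol\Upsilon(0,c_{23}))$ over $c_{23}\in\mathbb R$ is attained at $c_{23}^*=\dfrac{2}{a_\alpha^{\min}(\kappa+1)}$, and the minimal value is $\dfrac{\kappa-1}{\kappa+1}$.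
   Context: Let $\mathbf A\in\mathbb R^{N\times N}$ be symmetric positive-definite (SPD). Let $\mathbf I_H^h\in\mathbb R^{N\times N_c}$ (prolongation) have full column rank, let $\mathbf I_h^H=(\mathbf I_H^h)^{\mathcal T}$ (restriction), let $\mathbf A_H\in\mathbb R^{N_c\times N_c}$ be SPD (coarse-grid matrix), and let $\mathcal P\in\mathbb R^{N\times N}$ be SPD (preconditioner). For $\alpha\in(0,1]$ define $$\mathbf A_\alpha=\left(\alpha\mathcal P+(1-\alpha)\mathbf I_H^h\mathbf A_H^{-1}\mathbf I_h^H\right)\mathbf A .$$ For $c_1,c_{23}\in\mathbb R$ define $\mathbf B=(1+c_1)\mathbf I-c_{23}\mathbf A_\alpha$ (with $\mathbf I$ the $N\times N$ identity) and the $2N\times 2N$ matrix $$\boldsymbol\Upsilon(c_1,c_{23})=\begin{bmatrix}\mathbf B&-c_1\mathbf I\\ \mathbf I&\mathbf 0\end{bmatrix}.$$ This is the error-propagation matrix of the iteration $\mathbf x_k = \mathbf x_{k-1}+c_1(\mathbf x_{k-1}-\mathbf x_{k-2})+c_2\mathcal P(\mathbf f-\mathbf A\mathbf x_{k-1})+c_3\mathbf I_H^h\mathbf A_H^{-1}\mathbf I_h^H(\mathbf f-\mathbf A\mathbf x_{k-1})$ with $c_2=\alpha c_{23}$, $c_3=(1-\alpha)c_{23}$. *)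

(* Defs.v *)
From HB Require Import structures.
From mathcomp Require Import all_boot all_order all_algebra.
From mathcomp Require Import complex.
From mathcomp Require Import classical_sets reals.

Set Implicit Arguments.
Unset Strict Implicit.
Unset Printing Implicit Defensive.

Import Order.TTheory GRing.Theory Num.Theory.

Local Open Scope classical_set_scope.
Local Open Scope ring_scope.

Definition spd (R : realType) (n : nat) (M : 'M[R]_n) : Prop :=
  M \is symmetricmx /\
  forall x : 'cV[R]_n, x != 0 -> 0 < (x^T *m M *m x) 0 0.

Definition complexmx (R : realType) (m n : nat) (M : 'M[R]_(m, n)) :
    'M[R[i]]_(m, n) :=
  map_mx (real_complex R) M.

(* For n > 0 the set is finite and nonempty, so its supremum is the maximum. *)
Definition spectral_radius (R : realType) (n : nat) (M : 'M[R]_n) : R :=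
  sup [set ComplexField.Normc.normc l
      | l in [set l : R[i] | eigenvalue (complexmx M) l]].

(* Extremal among the real eigenvalues; nothing is said here about the
   nonreal ones. *)
Definition smallest_eigenvalue (R : realType) (n : nat) (M : 'M[R]_n) (a : R) :
    Prop :=
  eigenvalue M a /\ forall b : R, eigenvalue M b -> a <= b.

Definition largest_eigenvalue (R : realType) (n : nat) (M : 'M[R]_n) (a : R) :
    Prop :=
  eigenvalue M a /\ forall b : R, eigenvalue M b -> b <= a.

(* P is the prolongation (its transpose the restriction), Q the
   preconditioner. *)
Definition A_alpha (R : realType) (N Nc : nat) (A : 'M[R]_N)
    (P : 'M[R]_(N, Nc)) (AH : 'M[R]_Nc) (Q : 'M[R]_N) (alpha : R) : 'M[R]_N :=
  (alpha *: Q + (1 - alpha) *: (P *m invmx AH *m P^T)) *m A.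

Definition Upsilon (R : realType) (N : nat) (Aa : 'M[R]_N) (c1 c23 : R) :
    'M[R]_(N + N) :=
  block_mx ((1 + c1)%:M - c23 *: Aa) (- c1%:M)
           1%:M                      0.

(* Main.v *)
Require Import Defs.
From HB Require Import structures.
From mathcomp Require Import all_boot all_order all_algebra.
From mathcomp Require Import complex.
From mathcomp Require Import classical_sets reals.
From mathcomp Require Import ring lra.

Import Order.TTheory GRing.Theory Num.Theory.

Local Open Scope ring_scope.

(** [A_alpha] is a product [M * A] of two SPD matrices, so its eigenvalues are
    real and positive.  A nonzero [l] is an eigenvalue of [Upsilon c1 c23] iff
    [l^2 - (1 + c1 - c23 a) l + c1 = 0] for some eigenvalue [a] of [A_alpha]
    (when [c23 <> 0]).  If all roots of [p_a = l^2 - b_a l + c1] have modulus at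
    most [r], then [c1 <= r^2], [p_a(r) >= 0] and [p_a(-r) >= 0]; combining
    [p(r) >= 0] at the smallest [a] with [p(-r) >= 0] at the largest one
    eliminates [c23] and gives, for [r < 1],
    [kappa (1 - r) (r - c1) <= (1 + r) (r + c1)], hence
    [kappa (1 - r)^2 <= (1 + r)^2].  At the optimum all the [p_a] have
    nonpositive discriminant, so all their roots have modulus [sqrt c1]. *)

(** * Closure properties of SPD matrices *)

Lemma spd_tr (R : realType) (n : nat) (M : 'M[R]_n) : spd M -> M^T = M.
Proof. by case=> /is_hermitianmxP + _; rewrite expr0 scale1r map_mx_id. Qed.

Lemma spd_row_gt0 (R : realType) (n : nat) (M : 'M[R]_n) (x : 'rV[R]_n) :
  spd M -> x != 0 -> 0 < (x *m M *m x^T) 0 0.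
Proof.
by case=> _ /(_ x^T) posM x_neq0; rewrite -{1}[x]trmxK posM // trmx_eq0.
Qed.

Lemma spd_quad_ge0 (R : realType) (n : nat) (M : 'M[R]_n) (x : 'cV[R]_n) :
  spd M -> 0 <= (x^T *m M *m x) 0 0.
Proof.
case=> _ posM; have [->|/posM/ltW//] := eqVneq x 0.
by rewrite mulmx0 mxE.
Qed.

Lemma spd_invmx (R : realType) (n : nat) (M : 'M[R]_n) :
  spd M -> spd (invmx M).
Proof.
(* [invmx] returns a singular matrix unchanged, so that case is the hypothesis itself. *)
move=> spdM; have [unitM|/invmx_out-> //] := boolP (M \in unitmx).
split.
  apply/is_hermitianmxP.
  by rewrite expr0 scale1r map_mx_id // trmx_inv spd_tr.
move=> x x_neq0.
have y_neq0 : invmx M *m x != 0.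
  by apply: contra_neq x_neq0 => y0; rewrite -[x](mulKVmx unitM) y0 mulmx0.
have := spdM.2 _ y_neq0.
by rewrite trmx_mul trmx_inv spd_tr // mulmxKV // mulmxA.
Qed.

(** The congruence term is $(P^T x)^T M (P^T x) \ge 0$, possibly zero; strict positivity comes from
    [Q] and [0 < s]. *)
Lemma spd_add_congr (R : realType) (n m : nat) (Q : 'M[R]_n)
    (P : 'M[R]_(n, m)) (M : 'M[R]_m) (s t : R) :
  spd Q -> spd M -> 0 < s -> 0 <= t ->
  spd (s *: Q + t *: (P *m M *m P^T)).
Proof.
move=> spdQ spdM s_gt0 t_ge0; split.
  apply/is_hermitianmxP; rewrite expr0 scale1r map_mx_id // !linearP /=.
  by rewrite !linearZ /= !trmx_mul trmxK !spd_tr // mulmxA.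
move=> x x_neq0; rewrite mulmxDr mulmxDl mxE ltr_wpDr //.
  rewrite -scalemxAr -scalemxAl mxE mulr_ge0 //.
  by have := spd_quad_ge0 _ _ _ (P^T *m x) spdM; rewrite trmx_mul trmxK !mulmxA.
by rewrite -scalemxAr -scalemxAl mxE mulr_gt0 //; apply: spdQ.2.
Qed.

(** * Spectrum of a product of two SPD matrices *)

Lemma eigenvalue_complexmxP (R : realType) (n : nat) (M : 'M[R]_n) (a b : R) :
  eigenvalue (complexmx M) (Complex a b) ->
  exists x y : 'rV[R]_n, [/\ (x != 0) || (y != 0),
    x *m M = a *: x - b *: y & y *m M = b *: x + a *: y].
Proof.
case/eigenvalueP=> v vM v_neq0.
have ReS (I : finType) (F : I -> R[i]) : complex.Re (\sum_i F i) = \sum_i complex.Re (F i).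
  by apply: (big_ind2 (fun z r => complex.Re z = r)) => // -[? ?] ? [? ?] ? <- <-.
have ImS (I : finType) (F : I -> R[i]) : complex.Im (\sum_i F i) = \sum_i complex.Im (F i).
  by apply: (big_ind2 (fun z r => complex.Im z = r)) => // -[? ?] ? [? ?] ? <- <-.
exists (map_mx (@complex.Re R) v), (map_mx (@complex.Im R) v); split.
- apply: contraNT v_neq0; rewrite negb_or !negbK => /andP[/eqP x0 /eqP y0].
  apply/eqP/rowP => j; move/rowP: x0 => /(_ j); move/rowP: y0 => /(_ j).
  by rewrite !mxE; case: (v 0 j) => ? ? /= -> ->.
- apply/rowP => j; move/rowP: vM => /(_ j); rewrite !mxE => /(congr1 (@complex.Re R)).
  rewrite ReS; case: (v 0 j) => c d /= <-; apply: eq_bigr => k _.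
  by rewrite !mxE; case: (v 0 k) => ? ? /=; ring.
- apply/rowP => j; move/rowP: vM => /(_ j); rewrite !mxE => /(congr1 (@complex.Im R)).
  rewrite ImS; case: (v 0 j) => c d /= vM; rewrite addrC -vM.
  apply: eq_bigr => k _.
  by rewrite !mxE; case: (v 0 k) => ? ? /=; ring.
Qed.

(* For a left eigenvector [x + i y] of [M A], pairing with [M x] and [M y]
   expresses the symmetric form [M A M] through the symmetric form [M]. *)
Lemma eigenvalue_mul_spd (R : realType) (n : nat) (M A : 'M[R]_n) (l : R[i]) :
  spd M -> spd A -> eigenvalue (complexmx (M *m A)) l ->
  exists2 a : R, 0 < a & l = real_complex R a.
Proof.
move=> spdM spdA; case: l => a b /eigenvalue_complexmxP[x [y [xy0 xMA yMA]]].
pose q (S : 'M[R]_n) (u v : 'rV[R]_n) := (u *m S *m v^T) 0 0.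
have qC S u v : S^T = S -> q S u v = q S v u.
  move=> symS; rewrite /q -[u *m S *m _]trmxK [LHS]mxE.
  by rewrite !trmx_mul trmxK symS mulmxA.
have qD S u v w : q S (u + v) w = q S u w + q S v w by rewrite /q !mulmxDl mxE.
have qZ S c u w : q S (c *: u) w = c * q S u w.
  by rewrite /q -!scalemxAl mxE.
have qMAM u w : q (M *m A *m M) u w = q M (u *m (M *m A)) w.
  by rewrite /q !mulmxA.
have symMAM : (M *m A *m M)^T = M *m A *m M.
  by rewrite !trmx_mul !spd_tr // mulmxA.
have qM_gt0 u : u != 0 -> 0 < q M u u by exact: spd_row_gt0.
have qM_ge0 u : 0 <= q M u u.
  by have [->|/qM_gt0/ltW//] := eqVneq u 0; rewrite /q !mul0mx mxE.
have qMAM_gt0 u : u != 0 -> 0 < q (M *m A *m M) u u.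
  move=> u_neq0; have -> : q (M *m A *m M) u u = q A (u *m M) (u *m M).
    by rewrite /q trmx_mul spd_tr // !mulmxA.
  apply: spd_row_gt0 => //; apply: contraTneq (qM_gt0 u u_neq0) => uM0.
  by rewrite /q uM0 mul0mx mxE ltxx.
have qx w : q (M *m A *m M) x w = a * q M x w - b * q M y w.
  by rewrite qMAM xMA -scaleNr qD !qZ mulNr.
have qy w : q (M *m A *m M) y w = b * q M x w + a * q M y w.
  by rewrite qMAM yMA qD !qZ.
have q_gt0 : 0 < q M x x + q M y y.
  by case/orP: xy0 => /qM_gt0 ?; [rewrite ltr_wpDr | rewrite ltr_wpDl].
(* Symmetry of [M *m A *m M] gives $a q(x,y) - b q(y,y) = b q(x,x) + a q(y,x)$ with [q] taken at
   [M]; the terms in $a$ cancel. *)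
have b0 : b = 0.
  have := qC _ x y symMAM; rewrite qx qy (qC M y x) ?spd_tr // => e.
  have /eqP : b * (q M x x + q M y y) = 0 by lra.
  by rewrite mulf_eq0 (gt_eqF q_gt0) orbF => /eqP.
exists a; last by rewrite b0.
(* Now [a] times the positive [q M x x + q M y y] is the same sum for [M *m A *m M], which is
   positive too. *)
rewrite -(pmulr_lgt0 a q_gt0) mulrDr; move: qx qy; rewrite b0.
move=> /(_ x) qx /(_ y) qy; rewrite mul0r subr0 in qx; rewrite mul0r add0r in qy.
rewrite -qx -qy.
have q_ge0 u : 0 <= q (M *m A *m M) u u.
  by have [->|/qMAM_gt0/ltW//] := eqVneq u 0; rewrite /q !mul0mx mxE.
by case/orP: xy0 => /qMAM_gt0 ?; [rewrite ltr_wpDr | rewrite ltr_wpDl].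
Qed.

Lemma eigenvalue_A_alpha (R : realType) (N Nc : nat) (A : 'M[R]_N)
    (P : 'M[R]_(N, Nc)) (AH : 'M[R]_Nc) (Q : 'M[R]_N) (alpha : R) (l : R[i]) :
  spd A -> spd AH -> spd Q -> 0 < alpha <= 1 ->
  eigenvalue (complexmx (A_alpha A P AH Q alpha)) l ->
  exists2 a : R, 0 < a & l = real_complex R a.
Proof.
move=> spdA spdAH spdQ /andP[alpha_gt0 alpha_le1].
apply: eigenvalue_mul_spd => //; apply: spd_add_congr => //.
  exact: spd_invmx.
by rewrite subr_ge0.
Qed.

(** * Spectral radius and eigenvalue moduli *)

Lemma complexmx_eigenvalue_ex (R : realType) (n : nat) (M : 'M[R]_n) :
  (0 < n)%N -> exists l, eigenvalue (complexmx M) l.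
Proof.
move=> n_gt0; have /closed_rootP[l rl] : size (char_poly (complexmx M)) != 1%N.
  by rewrite size_char_poly eqSS -lt0n.
by exists l; rewrite eigenvalue_root_char.
Qed.

Lemma eigenvalue_le_spectral_radius (R : realType) (n : nat) (M : 'M[R]_n)
    (l : R[i]) :
  eigenvalue (complexmx M) l ->
  ComplexField.Normc.normc l <= spectral_radius M.
Proof.
move=> eigl; apply: ub_le_sup; last by exists l.
have [s char_s] := closed_field_poly_normal (char_poly (complexmx M)).
(* The set of moduli is bounded by their sum over all roots of the characteristic polynomial. *)
exists (\sum_(z <- s) ComplexField.Normc.normc z) => _ [z eigz <-].
have normc_ge0 (w : R[i]) : 0 <= ComplexField.Normc.normc w.
  by case: w => u v; rewrite sqrtr_ge0.
have zs : z \in s.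
  move: eigz; rewrite /= eigenvalue_root_char char_s.
  by rewrite (monicP (char_poly_monic _)) scale1r root_prod_XsubC.
by rewrite (big_rem _ zs) /= lerDl sumr_ge0.
Qed.

Lemma spectral_radius_le (R : realType) (n : nat) (M : 'M[R]_n) (r : R) :
  (0 < n)%N ->
  (forall l, eigenvalue (complexmx M) l -> ComplexField.Normc.normc l <= r) ->
  spectral_radius M <= r.
Proof.
move=> n_gt0 le_r; apply: ge_sup => [|_ [l eigl <-]]; last exact: le_r.
have [l eigl] := complexmx_eigenvalue_ex _ _ M n_gt0.
by exists (ComplexField.Normc.normc l); exists l.
Qed.

(** * Eigenvalues of [Upsilon] as roots of quadratics *)

(* Eigenvectors are rows here: [(u, v)] is one for [l] iff
   [u B + v = l u] and [- c u = l v], where [B = (1 + c) I - d A]. *)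
Lemma companion_block_eigenvalue_of_root (F : fieldType) (n : nat) (A : 'M[F]_n)
    (c d l a : F) :
  eigenvalue A a -> l ^+ 2 - (1 + c - d * a) * l + c = 0 ->
  eigenvalue (block_mx ((1 + c)%:M - d *: A) (- c%:M) 1%:M 0) l.
Proof.
move=> /eigenvalueP[u uA u_neq0] root_l; apply/eigenvalueP.
(* The second block is forced by $u B + v = l u$. *)
exists (row_mx u ((l - (1 + c - d * a)) *: u)).
  rewrite mul_row_block mulmx1 mulmx0 addr0 scale_row_mx scalerA.
  rewrite mulmxBr mulmxN !mul_mx_scalar -scalemxAr uA scalerA -!scaleNr -!scalerDl.
  by congr (row_mx (_ *: _) (_ *: _)); [ring | rewrite -[RHS]subr0 -root_l; ring].
by apply: contra_neq u_neq0 => /eqP; rewrite -row_mx0 => /eqP/eq_row_mx[].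
Qed.

(** As $l \ne 0$, $v = -(c/l) u$; substituting, $d\, u A = (1 + c - l - c/l) u$, and dividing by $d$
    gives $a$. *)
Lemma companion_block_root_of_eigenvalue (F : fieldType) (n : nat) (A : 'M[F]_n)
    (c d l : F) :
  d != 0 -> l != 0 ->
  eigenvalue (block_mx ((1 + c)%:M - d *: A) (- c%:M) 1%:M 0) l ->
  exists2 a, eigenvalue A a & l ^+ 2 - (1 + c - d * a) * l + c = 0.
Proof.
move=> d_neq0 l_neq0 /eigenvalueP[w]; rewrite -[w]hsubmxK.
move: (lsubmx w) (rsubmx w) => u v.
rewrite mul_row_block mulmx1 mulmx0 addr0 scale_row_mx => /eq_row_mx[uv vu] uv_neq0.
rewrite mulmxN mul_mx_scalar in vu.
have {}vu : v = - (c / l) *: u.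
  by apply: (scalerI l_neq0); rewrite -vu scalerA -scaleNr; congr (_ *: _); field.
exists ((1 + c - l - c / l) / d); last by field; rewrite d_neq0.
apply/eigenvalueP; exists u; last first.
  by apply: contra_neq uv_neq0 => u0; rewrite vu u0 scaler0 row_mx0.
apply: (scalerI d_neq0); rewrite scalerA mulrCA divff // mulr1.
move: uv; rewrite mulmxBr mul_mx_scalar -scalemxAr vu => e.
by rewrite !scalerBl -e scaleNr; apply/rowP => j; rewrite !mxE; ring.
Qed.

Lemma complexmx_Upsilon (R : realType) (N : nat) (Aa : 'M[R]_N) (c d : R) :
  complexmx (Upsilon Aa c d) =
  block_mx ((1 + real_complex R c)%:M - real_complex R d *: complexmx Aa)
           (- (real_complex R c)%:M) 1%:M 0.
Proof.
rewrite /complexmx map_block_mx map_mxB map_mxZ map_mxN !map_scalar_mx map_mx0.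
by rewrite rmorphD rmorph1.
Qed.

Lemma eigenvalue_Upsilon_of_root (R : realType) (N : nat) (Aa : 'M[R]_N)
    (c d a : R) (l : R[i]) :
  eigenvalue Aa a ->
  l ^+ 2 - real_complex R (1 + c - d * a) * l + real_complex R c = 0 ->
  eigenvalue (complexmx (Upsilon Aa c d)) l.
Proof.
move=> eiga root_l; rewrite complexmx_Upsilon.
apply: (companion_block_eigenvalue_of_root _ _ _ _ _ _ (real_complex R a)).
  by rewrite eigenvalue_map.
by rewrite -root_l rmorphB rmorphD rmorphM rmorph1.
Qed.

Lemma root_of_eigenvalue_Upsilon (R : realType) (N : nat) (Aa : 'M[R]_N)
    (c d : R) (l : R[i]) :
  (forall z, eigenvalue (complexmx Aa) z ->
     exists2 a : R, 0 < a & z = real_complex R a) ->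
  d != 0 -> l != 0 -> eigenvalue (complexmx (Upsilon Aa c d)) l ->
  exists2 a : R, eigenvalue Aa a &
    l ^+ 2 - real_complex R (1 + c - d * a) * l + real_complex R c = 0.
Proof.
move=> real_eig d_neq0 l_neq0; rewrite complexmx_Upsilon.
case/companion_block_root_of_eigenvalue => // [|z eigz root_l].
  by rewrite fmorph_eq0.
have [a _ za] := real_eig z eigz; rewrite za in eigz root_l; exists a.
  by rewrite -(eigenvalue_map (real_complex R)).
by rewrite rmorphB rmorphD rmorphM rmorph1.
Qed.

(** * Moduli of the roots of real quadratics *)

Lemma normc_le (R : realType) (x y r : R) :
  0 <= r ->
  (ComplexField.Normc.normc (Complex x y) <= r) = (x ^+ 2 + y ^+ 2 <= r ^+ 2).
Proof.
by move=> r_ge0; rewrite /= -[r in LHS](ger0_norm r_ge0) -sqrtr_sqr ler_psqrt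
  // nnegrE ?addr_ge0 ?sqr_ge0.
Qed.

Lemma normc_real (R : realType) (x : R) :
  ComplexField.Normc.normc (real_complex R x) = `|x|.
Proof. by rewrite /= expr0n addr0 sqrtr_sqr. Qed.

Lemma complex_quadraticE (R : realType) (b c x y : R) :
  (Complex x y ^+ 2 - real_complex R b * Complex x y + real_complex R c = 0) <->
  x ^+ 2 - y ^+ 2 - b * x + c = 0 /\ (2 * x - b) * y = 0.
Proof.
split=> [[e1 e2] | [e1 e2]].
  by split; [rewrite -[RHS]e1 | rewrite -[RHS]e2]; ring.
by congr Complex; [rewrite -[RHS]e1 | rewrite -[RHS]e2]; ring.
Qed.

(** Real roots lie in $[-r, r]$, so their product $c$ is at most $r^2$ and the factors of $p(\pm r)$
    have equal signs. Nonreal roots have $|l|^2 = c$, and $p$ is positive on the real line. *)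
Lemma quadratic_roots_bounded (R : realType) (b c r : R) :
  0 <= r ->
  (forall l : R[i], l ^+ 2 - real_complex R b * l + real_complex R c = 0 ->
     ComplexField.Normc.normc l <= r) ->
  [/\ c <= r ^+ 2, 0 <= r ^+ 2 - b * r + c & 0 <= r ^+ 2 + b * r + c].
Proof.
move=> r_ge0 roots_le_r; have [disc_ge0|disc_lt0] := leP 0 (b ^+ 2 - 4 * c).
  pose s := Num.sqrt (b ^+ 2 - 4 * c).
  have s2 : s ^+ 2 = b ^+ 2 - 4 * c by rewrite sqr_sqrtr.
  have real_root t : t ^+ 2 = s ^+ 2 -> `|(b + t) / 2| <= r.
    move=> t2; rewrite -normc_real; apply: roots_le_r.
    by apply/complex_quadraticE; split; [move: t2; rewrite s2; nra | rewrite mulr0].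
  have := real_root s erefl; have := real_root (- s) (sqrrN s).
  rewrite !ler_norml => /andP[? ?] /andP[? ?].
  by split; nra.
pose s := Num.sqrt (4 * c - b ^+ 2).
have s2 : s ^+ 2 = 4 * c - b ^+ 2 by rewrite sqr_sqrtr //; lra.
have : ComplexField.Normc.normc (Complex (b / 2) (s / 2)) <= r.
  by apply/roots_le_r/complex_quadraticE; split; nra.
by rewrite normc_le // => ?; split; nra.
Qed.

(** The discriminant $b^2 - 4q^2$ is nonpositive: a nonreal root has squared modulus $q^2$, a real
    one is the double root $b/2$. *)
Lemma quadratic_root_norm_le (R : realType) (b q : R) (l : R[i]) :
  0 <= q -> - (2 * q) <= b <= 2 * q ->
  l ^+ 2 - real_complex R b * l + real_complex R (q ^+ 2) = 0 ->
  ComplexField.Normc.normc l <= q.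
Proof.
case: l => x y q_ge0 /andP[? ?] /complex_quadraticE[e1 e2]; rewrite normc_le //.
have [y0|y_neq0] := eqVneq y 0; last first.
  by move/eqP: e2; rewrite mulf_eq0 (negPf y_neq0) orbF => /eqP ?; nra.
have : (x - b / 2) ^+ 2 <= 0 by rewrite y0 in e1; nra.
by rewrite y0; nra.
Qed.

(** * Lower bounds on the spectral radius *)

(** Here [s] stands for $\sqrt\kappa$ and [a] for the smallest eigenvalue, so $s^2 a$ is the
    largest. *)
Lemma momentum_rate_le (R : realType) (s a c d r : R) :
  1 < s -> 0 < r -> c <= r ^+ 2 ->
  0 <= r ^+ 2 - (1 + c - d * a) * r + c ->
  0 <= r ^+ 2 + (1 + c - d * (s ^+ 2 * a)) * r + c ->
  (s - 1) / (s + 1) <= r.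
Proof.
move=> s_gt1 r_gt0 c_le pos_r neg_r.
rewrite ler_pdivrMr; last by lra.
have [r_ge1|r_lt1] := leP 1 r; first by nra.
have lo : (1 - r) * (r - c) <= r * (d * a) by lra.
have hi : s ^+ 2 * (r * (d * a)) <= (1 + r) * (r + c) by lra.
(* From $c \le r^2$: $r - c \ge r(1 - r)$ here, and $r + c \le r(1 + r)$ for [hi]. *)
have {}lo : r * (1 - r) ^+ 2 <= r * (d * a).
  by apply: le_trans lo; rewrite -subr_ge0; nra.
have {}hi : s ^+ 2 * (r * (d * a)) <= r * (1 + r) ^+ 2.
  by apply: le_trans hi _; rewrite -subr_ge0; nra.
have : s ^+ 2 * (r * (1 - r) ^+ 2) <= r * (1 + r) ^+ 2.
  by apply: le_trans hi; rewrite ler_wpM2l // sqr_ge0.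
(* Cancelling $r$ and taking square roots leaves $s(1 - r) \le 1 + r$. *)
rewrite mulrCA ler_pM2l // -exprMn ler_pXn2r ?nnegrE //; first by lra.
  by rewrite mulr_ge0; lra.
by lra.
Qed.

Lemma spectral_radius_Upsilon_ge (R : realType) (N : nat) (Aa : 'M[R]_N)
    (s a c d : R) :
  1 < s -> eigenvalue Aa a -> eigenvalue Aa (s ^+ 2 * a) ->
  (s - 1) / (s + 1) <= spectral_radius (Upsilon Aa c d).
Proof.
move=> s_gt1 eig_a eig_sa.
have rate_le r : 0 < r -> spectral_radius (Upsilon Aa c d) <= r ->
    (s - 1) / (s + 1) <= r.
  move=> r_gt0 rho_le.
  have roots_le b l : eigenvalue Aa b ->
      l ^+ 2 - real_complex R (1 + c - d * b) * l + real_complex R c = 0 ->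
      ComplexField.Normc.normc l <= r.
    move=> eigb /(eigenvalue_Upsilon_of_root _ _ _ _ _ _ _ eigb) eigl.
    exact: le_trans (eigenvalue_le_spectral_radius _ _ _ _ eigl) rho_le.
  have [c_le pos_r _] :=
    quadratic_roots_bounded _ _ _ _ (ltW r_gt0) (fun l => roots_le a l eig_a).
  have [_ _ neg_r] :=
    quadratic_roots_bounded _ _ _ _ (ltW r_gt0) (fun l => roots_le _ l eig_sa).
  exact: (momentum_rate_le _ s a c d).
have rate_gt0 : 0 < (s - 1) / (s + 1) by rewrite divr_gt0; lra.
rewrite leNgt; apply/negP => rho_lt.
(* [r] is positive even if the spectral radius vanishes. *)
pose r := Num.max (spectral_radius (Upsilon Aa c d)) ((s - 1) / (s + 1) / 2).
have : (s - 1) / (s + 1) <= r.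
  by apply: rate_le; rewrite ?lt_max ?le_max ?lexx // divr_gt0 ?orbT.
by rewrite le_max leNgt rho_lt /=; lra.
Qed.

(** For $c_1 = 0$ each $1 - d b$ is a root, so $1 - \rho \le d a$ and $k d a \le 1 + \rho$;
    eliminating $d a$ gives $k(1 - \rho) \le 1 + \rho$. *)
Lemma spectral_radius_Upsilon0_ge (R : realType) (N : nat) (Aa : 'M[R]_N)
    (k a d : R) :
  0 < k -> eigenvalue Aa a -> eigenvalue Aa (k * a) ->
  (k - 1) / (k + 1) <= spectral_radius (Upsilon Aa 0 d).
Proof.
move=> k_gt0 eig_a eig_ka; set rho := spectral_radius _.
have le_rho b : eigenvalue Aa b -> `|1 - d * b| <= rho.
  move=> eigb; rewrite -normc_real; apply: eigenvalue_le_spectral_radius.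
  apply: (eigenvalue_Upsilon_of_root _ _ _ _ _ _ _ eigb).
  by apply/complex_quadraticE; split; ring.
move: (le_rho _ eig_a) (le_rho _ eig_ka); rewrite !ler_norml.
move=> /andP[_ da] /andP[dka _]; rewrite ler_pdivrMr; last by lra.
have : k * (1 - rho) <= k * (d * a) by rewrite ler_pM2l //; lra.
by lra.
Qed.

(** * Upper bounds and optimal parameters *)

Lemma spectral_radius_Upsilon_le (R : realType) (N : nat) (Aa : 'M[R]_N)
    (amin amax c d q : R) :
  (forall z, eigenvalue (complexmx Aa) z ->
     exists2 a : R, 0 < a & z = real_complex R a) ->
  smallest_eigenvalue Aa amin -> largest_eigenvalue Aa amax ->
  0 < d -> 0 <= q ->
  (forall a l, amin <= a <= amax ->
     l ^+ 2 - real_complex R (1 + c - d * a) * l + real_complex R c = 0 ->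
     ComplexField.Normc.normc l <= q) ->
  spectral_radius (Upsilon Aa c d) <= q.
Proof.
move=> real_eig [eig_min min_le] [_ le_max] d_gt0 q_ge0 roots_le.
apply: spectral_radius_le.
  (* [N = 0] is impossible: [amin] has a nonzero eigenvector. *)
  by case: N Aa {real_eig min_le le_max} eig_min => // Aa /eigenvalueP[v _];
    rewrite thinmx0 eqxx.
move=> l; have [->|l_neq0] := eqVneq l 0.
  by rewrite (normc_real R 0) normr0.
case/root_of_eigenvalue_Upsilon => // [|a eiga]; first by rewrite gt_eqF.
by apply: roots_le; rewrite min_le ?le_max.
Qed.

Theorem mainTheorem1 (R : realType) (N Nc : nat)
    (A : 'M[R]_N) (P : 'M[R]_(N, Nc)) (AH : 'M[R]_Nc) (Q : 'M[R]_N)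
    (alpha : R)
    (hA : spd A) (hP : \rank P = Nc) (hAH : spd AH) (hQ : spd Q)
    (halpha : 0 < alpha <= 1) :
  let Aa := A_alpha A P AH Q alpha in
  let rho := fun c1 c23 : R => spectral_radius (Upsilon Aa c1 c23) in
  (forall l : R[i], eigenvalue (complexmx Aa) l ->
     exists2 a : R, 0 < a & l = real_complex R a) /\
  (forall amin amax : R,
     smallest_eigenvalue Aa amin -> largest_eigenvalue Aa amax ->
     let kappa := amax / amin in
     let sk := Num.sqrt kappa in
     1 < kappa ->
     (let c1s := ((sk - 1) / (sk + 1)) ^+ 2 in
      let c23s := 4 / (amin * (sk + 1) ^+ 2) in
      (forall c1 c23 : R, rho c1s c23s <= rho c1 c23) /\
      rho c1s c23s = (sk - 1) / (sk + 1)) /\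
     (let c23s := 2 / (amin * (kappa + 1)) in
      (forall c23 : R, rho 0 c23s <= rho 0 c23) /\
      rho 0 c23s = (kappa - 1) / (kappa + 1))).
Proof.
move=> Aa rho; split=> [l|amin amax minA maxA kappa sk kappa_gt1].
  exact: eigenvalue_A_alpha.
have real_eig z : eigenvalue (complexmx Aa) z ->
    exists2 a : R, 0 < a & z = real_complex R a by exact: eigenvalue_A_alpha.
have amin_gt0 : 0 < amin.
  have [|a a_gt0 [->//]] := real_eig (real_complex R amin).
  by rewrite eigenvalue_map minA.1.
have amaxE : amax = kappa * amin by rewrite divfK ?gt_eqF.
have sk2 : sk ^+ 2 = kappa by rewrite sqr_sqrtr; lra.
have sk_gt1 : 1 < sk by rewrite -sqrtr1 ltr_sqrt //; lra.
have eig_ka : eigenvalue Aa (kappa * amin) by rewrite -amaxE maxA.1.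
split.
  move=> c1s c23s.
  have lower c1 c23 : (sk - 1) / (sk + 1) <= rho c1 c23.
    by apply: (spectral_radius_Upsilon_ge _ _ _ _ amin); rewrite ?sk2 ?minA.1.
  have upper : rho c1s c23s <= (sk - 1) / (sk + 1).
    have d_gt0 : 0 < c23s.
      by rewrite divr_gt0 // mulr_gt0 // exprn_gt0 //; lra.
    have q_ge0 : 0 <= (sk - 1) / (sk + 1) by apply: divr_ge0; lra.
    apply: (spectral_radius_Upsilon_le _ _ _ amin amax) => // a l /andP[lo hi].
    apply: quadratic_root_norm_le => //.
    have sk1_neq0 : sk + 1 != 0 by rewrite gt_eqF //; lra.
    (* With $q$ the claimed rate, $c_{23}^* a$ lies in $[(1-q)^2, (1+q)^2]$, so $1 + q^2 - c_{23}^*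
       a$ lies in $[-2q, 2q]$. *)
    have dmin : c23s * amin = (1 - (sk - 1) / (sk + 1)) ^+ 2.
      by rewrite /c23s; field; rewrite sk1_neq0 gt_eqF.
    have dmax : c23s * amax = (1 + (sk - 1) / (sk + 1)) ^+ 2.
      by rewrite amaxE -sk2 /c23s; field; rewrite sk1_neq0 gt_eqF.
    have := ler_wpM2l (ltW d_gt0) lo; have := ler_wpM2l (ltW d_gt0) hi.
    by rewrite dmin dmax /c1s => ? ?; apply/andP; split; lra.
  by split=> [c1 c23|]; [apply: le_trans upper (lower _ _) | apply/le_anti/andP].
move=> c23s.
have lower c23 : (kappa - 1) / (kappa + 1) <= rho 0 c23.
  by apply: (spectral_radius_Upsilon0_ge _ _ _ _ amin) => //; [lra | exact: minA.1].
have upper : rho 0 c23s <= (kappa - 1) / (kappa + 1).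
  have d_gt0 : 0 < c23s by rewrite divr_gt0 // mulr_gt0 //; lra.
  have q_ge0 : 0 <= (kappa - 1) / (kappa + 1) by apply: divr_ge0; lra.
  apply: (spectral_radius_Upsilon_le _ _ _ amin amax) => // a l /andP[lo hi].
  have k1_neq0 : kappa + 1 != 0 by rewrite gt_eqF //; lra.
  (* Now $c_{23}^* a$ lies in $[1-q, 1+q]$, so $|1 - c_{23}^* a| \le q$. *)
  have dmin : c23s * amin = 1 - (kappa - 1) / (kappa + 1).
    by rewrite /c23s; field; rewrite k1_neq0 gt_eqF.
  have dmax : c23s * amax = 1 + (kappa - 1) / (kappa + 1).
    by rewrite amaxE /c23s; field; rewrite k1_neq0 gt_eqF.
  have := ler_wpM2l (ltW d_gt0) lo; have := ler_wpM2l (ltW d_gt0) hi.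
  rewrite dmin dmax => dhi dlo; rewrite rmorph0 !addr0 => root_l.
  (* Without momentum the quadratic factors, with roots $0$ and $1 - c_{23}^* a$. *)
  have /eqP : l * (l - real_complex R (1 - c23s * a)) = 0.
    by rewrite -root_l; ring.
  rewrite mulf_eq0 subr_eq0 => /orP[] /eqP ->.
    by rewrite (normc_real R 0) normr0.
  by rewrite normc_real ler_norml; apply/andP; split; lra.
by split=> [c23|]; [apply: le_trans upper (lower _) | apply/le_anti/andP].
Qed.
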